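(* Let $N\ge 3$, and let $f,g,h$ be smooth real-valued functions of $(\bm{\theta}_N,t)$, where $\bm{\theta}_N=(\theta_1,\dots,\theta_N)$, $2\pi$-periodic in each $\theta_j$. Consider the system $$\frac{d\theta_j}{dt}=f(\bm{\theta}_N,t)+g(\bm{\theta}_N,t)\cos\theta_j+h(\bm{\theta}_N,t)\sin\theta_j,\qquad j=1,\dots,N,$$ with Perron--Frobenius generator $\mathcal{P}$. Then for every permutation $\bm{q}=(q^{(1)},\dots,q^{(N)})$ of $\{1,\dots,N\}$, the function $\psi^N_{\bm{q}}$ satisfies, at every point with $\theta_i\not\equiv\theta_j \pmod{2\pi}$ for all $i\ne j$ and every $t$, $$\mathcal{P}\psi^N_{\bm{q}}(\bm{\theta}_N)=\Lambda(\bm{\theta}_N,t)\,\psi^N_{\bm{q}}(\bm{\theta}_N),$$ where $$\Lambda(\bm{\theta}_N,t):=-\sum_{j=1}^N\left[\frac{\partial f(\bm{\theta}_N,t)}{\partial\theta_j}+\cos\theta_j\,\frac{\partial g(\bm{\theta}_N,t)}{\partial\theta_j}+\sin\theta_j\,\frac{\partial h(\bm{\theta}_N,t)}{\partial\theta_j}\right].$$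
   Context: The Perron--Frobenius generator of the system acts on a scalar function $u$ of $\bm{\theta}_N$ by $$\mathcal{P}u=-\sum_{j=1}^N\frac{\partial}{\partial\theta_j}\left[(f+g\cos\theta_j+h\sin\theta_j)\,u\right].$$ For a permutation $\bm{q}=(q^{(1)},\dots,q^{(N)})$ of $\{1,\dots,N\}$, with the cyclic convention $q^{(N+1)}:=q^{(1)}$, $$\psi^N_{\bm{q}}(\bm{\theta}_N):=\frac{1}{\prod_{j=1}^N\sin\left(\frac{\theta_{q^{(j)}}-\theta_{q^{(j+1)}}}{2}\right)},$$ considered on the set of phases that are pairwise distinct modulo $2\pi$. *)

(* Defs.v *)
From HB Require Import structures.
From mathcomp Require Import all_boot all_order all_algebra all_fingroup.
From mathcomp Require Import all_classical all_reals all_analysis.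

Set Implicit Arguments.
Unset Strict Implicit.
Unset Printing Implicit Defensive.

Import Order.TTheory GRing.Theory Num.Theory.
Import numFieldNormedType.Exports.

Local Open Scope ring_scope.

(* Iterated directional derivatives in all directions, up to order [k], exist
   everywhere and are continuous; on a finite-dimensional [V] this is C^k. *)
Fixpoint class_C (R : realType) (V : normedModType R) (k : nat) (F : V -> R)
    : Prop :=
  continuous F /\
  if k is k'.+1 then
    forall v : V, (forall x, derivable F x v) /\ class_C k' (fun x => 'D_v F x)
  else True.

Definition smooth (R : realType) (V : normedModType R) (F : V -> R) : Prop :=
  forall k, class_C k F.

Section Phases.
Variables (R : realType) (N : nat).
Implicit Types (theta : 'rV[R]_N) (f g h u : 'rV[R]_N -> R -> R) (t : R).

(* Joint smoothness in (theta, t). *)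
Definition smooth_in_phases_and_time f : Prop :=
  smooth (fun p : 'rV[R]_N * R => f p.1 p.2).

Definition periodic_2pi f : Prop :=
  forall (j : 'I_N) theta t,
    f (theta + (2 * pi) *: delta_mx ord0 j) t = f theta t.

Definition distinct_mod_2pi theta : Prop :=
  forall i j : 'I_N, i != j ->
    forall k : int, theta ord0 i != theta ord0 j + 2 * pi * k%:~R.

Definition partial (j : 'I_N) (u : 'rV[R]_N -> R) theta : R :=
  'D_(delta_mx ord0 j) u theta.

Definition velocity f g h (j : 'I_N) theta t : R :=
  f theta t + g theta t * cos (theta ord0 j) + h theta t * sin (theta ord0 j).

(* Generator of the system d theta_j / dt = v j theta t, at time t. *)
Definition PF_generator (v : 'I_N -> 'rV[R]_N -> R -> R) t
    (u : 'rV[R]_N -> R) theta : R :=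
  - \sum_(j < N) partial j (fun eta => v j eta t * u eta) theta.

(* [ordS] is the cyclic successor on 'I_N, giving q^(N+1) = q^(1). Where a
   factor vanishes, [psi] takes the junk value 0^-1 = 0. *)
Definition psi (q : 'S_N) theta : R :=
  (\prod_(j < N) sin ((theta ord0 (q j) - theta ord0 (q (ordS j))) / 2))^-1.

Definition Lambda f g h theta t : R :=
  - \sum_(j < N)
      (partial j (f ^~ t) theta
       + cos (theta ord0 j) * partial j (g ^~ t) theta
       + sin (theta ord0 j) * partial j (h ^~ t) theta).

End Phases.

(* Main.v *)
(* Write d_k for half the difference of the k-th and (k+1)-st phases along q and
   v_j = f + g cos theta_j + h sin theta_j. Logarithmic differentiation gives
     sum_j v_j partial_j psi = - psi * sum_k cot(d_k) (v_{q k} - v_{q (k+1)}) / 2.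
   By the sum-to-product formulas sin(d_k) factors out of the velocity
   difference, so the k-th term is the mean of F_{q k} and F_{q (k+1)}, where
   F_j = h cos theta_j - g sin theta_j. Summed over the cycle this is
   sum_j F_j, which cancels the part of the divergence of v that does not
   involve derivatives of f, g, h. *)
Require Import Defs.
From HB Require Import structures.
From mathcomp Require Import all_boot all_order all_algebra all_fingroup.
From mathcomp Require Import all_classical all_reals all_analysis.
From mathcomp Require Import ring.

Import Order.TTheory GRing.Theory Num.Theory.
Import numFieldNormedType.Exports.

Local Open Scope ring_scope.

(** Removing [Num.floor (x / pi)] multiples of [pi] leaves a remainder in [[0, pi)] at which sine
    still vanishes; positivity of sine on [(0, pi)] forces it to be 0. *)
Lemma sin_eq0_exists (R : realType) (x : R) :
  sin x = 0 -> exists k : int, x = pi * k%:~R.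
Proof.
move=> sx0; have pi0 := pi_gt0 R.
have shift_eq0 (k : int) (y : R) : sin y = 0 -> sin (y + pi * k%:~R) = 0.
  move=> y0; case: k => n.
    by rewrite -pmulrn mulr_natr (alternatingn (@sinDpi R)) y0 mulr0.
  (* For a negative shift, the natural-number rule is applied at the shifted point, so that going
     forward by [n.+1] half-periods returns to [y]. *)
  have := alternatingn (@sinDpi R) n.+1 (y + pi * (Negz n)%:~R).
  rewrite NegzE mulrNz mulrN -pmulrn mulr_natr subrK y0 => /esym/eqP.
  by rewrite mulf_eq0 signr_eq0 => /eqP.
exists (Num.floor (x / pi)); apply/eqP.
have /andP[] := floor_itv (x / pi).
set k := Num.floor _; rewrite ler_pdivlMr// ltr_pdivrMr// intrD => kx xk.
have := shift_eq0 (- k) x sx0; rewrite mulrNz mulrN => s0.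
rewrite -subr_eq0 eq_le; apply/andP; split; last by rewrite subr_ge0 mulrC.
rewrite leNgt; apply/negP => xk0.
suff /sin_gt0_pi : 0 < x - pi * k%:~R < pi by rewrite s0 ltxx.
by rewrite xk0 /= ltrBlDr -[X in _ < X + _]mulr1 -mulrDr mulrC addrC.
Qed.

Section DirectionalDerivatives.
Context {R : realType} {V : normedModType R}.

(** The two difference quotients coincide, so one-variable results such as the chain rule carry over
    to directional derivatives. *)
Lemma is_derive_line {W : normedModType R} (f : V -> W) (x v : V) (df : W) :
  is_derive 0 (1 : R) (fun s : R => f (s *: v + x)) df <-> is_derive x v f df.
Proof.
have e : (fun s : R => s^-1 *: (((fun s : R => f (s *: v + x)) \o shift 0)
              (s *: (1 : R)) - f ((0 : R) *: v + x)))
    = (fun s : R => s^-1 *: ((f \o shift x) (s *: v) - f x)).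
  by apply/funext => s /=; rewrite addr0 scale0r add0r [s%:A]mulr1.
by split=> -[] H1 H2; apply: DeriveDef;
  move: H1 H2; rewrite /derivable /derive e.
Qed.

Lemma is_derive_comp1 {f : V -> R} {g : R -> R} {x v : V} {df dg : R} :
  is_derive x v f df -> is_derive (f x) 1 g dg ->
  is_derive x v (fun y => g (f y)) (dg * df).
Proof.
move=> /is_derive_line Hf Hg; apply/is_derive_line.
by apply: is_derive1_comp Hf; rewrite scale0r add0r.
Qed.

Lemma is_deriveV_ndim {f : V -> R} {x v : V} {df : R} :
  f x != 0 -> is_derive x v f df ->
  is_derive x v (fun y => (f y)^-1) (- (f x) ^- 2 * df).
Proof.
move=> fx0 [Hf <-]; apply: DeriveDef; first exact: derivableV.
exact: deriveV.
Qed.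

(** With each derivative written as its factor times [c i], the logarithmic derivatives [c i] simply
    add up. *)
Lemma is_derive_prod_log {I : Type} (r : seq I) {F : I -> V -> R} {c : I -> R}
    {x v : V} :
  (forall i, is_derive x v (F i) (F i x * c i)) ->
  is_derive x v (fun y => \prod_(i <- r) F i y)
    ((\prod_(i <- r) F i x) * \sum_(i <- r) c i).
Proof.
move=> HF; elim: r => [|i r IH].
  rewrite !big_nil mulr0; under eq_fun do rewrite big_nil.
  exact: is_derive_cst.
under eq_fun do rewrite big_cons.
apply: (is_derive_eq (is_deriveM (HF i) IH)).
by rewrite !big_cons /GRing.scale /=; ring.
Qed.

End DirectionalDerivatives.

Lemma is_derive_coordinate {R : realType} {N : nat} (x v : 'rV[R]_N) (a : 'I_N) :
  is_derive x v (fun y : 'rV[R]_N => y ord0 a) (v ord0 a).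
Proof.
apply/is_derive_line.
rewrite (_ : (fun _ => _) = (fun s : R => s * v ord0 a + x ord0 a)); last first.
  by apply/funext => s; rewrite !mxE.
have H := is_deriveD (is_deriveM (is_derive_id (0 : R) (1 : R))
  (is_derive_cst (v ord0 a) (0 : R) (1 : R))) (is_derive_cst (x ord0 a) (0 : R) (1 : R)).
by apply: (is_derive_eq H); rewrite /GRing.scale /=; ring.
Qed.

(** With [s] the half-sum and [d] the half-difference of [a] and [b], both sides equal
    [cos d * (h * cos s - g * sin s)]. *)
Lemma half_cot_velocity_diff (R : realType) (f g h a b : R) :
  sin ((a - b) / 2) != 0 ->
  cos ((a - b) / 2) / sin ((a - b) / 2) *
    (((f + g * cos a + h * sin a) - (f + g * cos b + h * sin b)) / 2) =
  ((h * cos a - g * sin a) + (h * cos b - g * sin b)) / 2.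
Proof.
set d := (a - b) / 2; pose s := (a + b) / 2; move=> d0.
have -> : a = s + d by rewrite /s /d; field.
have -> : b = s - d by rewrite /s /d; field.
by rewrite !sinB !sinD !cosB !cosD; field.
Qed.

Section Phases.
Context {R : realType} {N : nat}.
Implicit Types (theta : 'rV[R]_N) (f g h : 'rV[R]_N -> R -> R) (q : 'S_N).

Lemma smooth_derivable f theta t (v : 'rV[R]_N) :
  smooth_in_phases_and_time f -> derivable (f ^~ t) theta v.
Proof.
(* The direction [(v, 0)] keeps time fixed, so joint smoothness restricts to the slice at time
   [t]. *)
move=> /(_ 1%N)[_ /(_ (v, 0))[/(_ (theta, t)) /derivableP + _]].
move=> /is_derive_line H.
rewrite (_ : (fun _ => _) = (fun s : R => f (s *: v + theta) t)) in H.
  by have [] := (is_derive_line (f ^~ t) _ _ _).1 H.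
by apply/funext => s /=; rewrite scaler0 add0r.
Qed.

Lemma smooth_is_derive f theta t (j : 'I_N) :
  smooth_in_phases_and_time f ->
  is_derive theta (delta_mx ord0 j) (f ^~ t) (partial j (f ^~ t) theta).
Proof. by move=> f_smooth; apply/derivableP/smooth_derivable. Qed.

(** The value is grouped into the summand of [Lambda] and the term from differentiating cosine and
    sine, which has to cancel later. *)
Lemma is_derive_velocity f g h theta t (j : 'I_N) :
  smooth_in_phases_and_time f -> smooth_in_phases_and_time g ->
  smooth_in_phases_and_time h ->
  is_derive theta (delta_mx ord0 j) (velocity f g h j ^~ t)
    (partial j (f ^~ t) theta + cos (theta ord0 j) * partial j (g ^~ t) theta
     + sin (theta ord0 j) * partial j (h ^~ t) theta
     + (h theta t * cos (theta ord0 j) - g theta t * sin (theta ord0 j))).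
Proof.
move=> /(@smooth_is_derive f theta t j) Hf /(@smooth_is_derive g theta t j) Hg.
move=> /(@smooth_is_derive h theta t j) Hh.
have Hj := is_derive_coordinate theta (delta_mx ord0 j) j.
have Hc := is_derive_comp1 Hj (is_derive_cos _).
have Hs := is_derive_comp1 Hj (is_derive_sin _).
apply: (is_derive_eq (is_deriveD (is_deriveD Hf (is_deriveM Hg Hc))
  (is_deriveM Hh Hs))).
by rewrite /GRing.scale /= mxE !eqxx !mulr1; ring.
Qed.

(** Linear in [theta]: applied to a direction [v], the same formula gives the derivative along
    [v]. *)
Definition half_gap q theta (k : 'I_N) : R :=
  (theta ord0 (q k) - theta ord0 (q (ordS k))) / 2.

Lemma is_derive_half_gap q theta (v : 'rV[R]_N) (k : 'I_N) :
  is_derive theta v (fun y => half_gap q y k) (half_gap q v k).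
Proof.
have Ha := is_derive_coordinate theta v (q k).
have Hb := is_derive_coordinate theta v (q (ordS k)).
apply: (is_derive_eq (is_deriveM (is_deriveB Ha Hb)
  (is_derive_cst (2^-1 : R) theta v))).
by rewrite /half_gap /GRing.scale /=; ring.
Qed.

Lemma is_derive_psi q theta (v : 'rV[R]_N) :
  (forall k, sin (half_gap q theta k) != 0) ->
  is_derive theta v (psi q)
    (- psi q theta * \sum_(k < N)
       cos (half_gap q theta k) / sin (half_gap q theta k) * half_gap q v k).
Proof.
move=> s0.
have Hk k : is_derive theta v (fun y => sin (half_gap q y k))
    (sin (half_gap q theta k) *
     (cos (half_gap q theta k) / sin (half_gap q theta k) * half_gap q v k)).
  apply: (is_derive_eq (is_derive_comp1 (is_derive_half_gap q theta v k)
    (is_derive_sin _))).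
  by field.
have p0 : \prod_(k < N) sin (half_gap q theta k) != 0.
  by apply/prodf_neq0 => k _.
apply: (is_derive_eq (is_deriveV_ndim p0 (is_derive_prod_log _ Hk))).
by rewrite /psi -/(half_gap q theta); field.
Qed.

Lemma sin_half_gap_neq0 q theta (k : 'I_N) :
  (1 < N)%N -> distinct_mod_2pi theta -> sin (half_gap q theta k) != 0.
Proof.
move=> N1 dist; apply/eqP => /sin_eq0_exists[m].
rewrite /half_gap => e.
have kS : q k != q (ordS k).
  rewrite (inj_eq perm_inj); apply/eqP => /(congr1 val) /= kk.
  (* The last index wraps around to 0, so being fixed would force [N = 1]; any other index moves to
     [k.+1]. *)
  have := ltn_ord k; rewrite leq_eqVlt => /orP[/eqP kN|kN].
    by move: kk N1; rewrite kN modnn => k0; move: kN; rewrite k0 => <-.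
  by move: kk; rewrite modn_small// => /n_Sn.
have /eqP := dist _ _ kS m; apply.
by rewrite -mulrA -e; field.
Qed.

(** Around the cycle each [F j] occurs in two means, each time with weight one half. *)
Lemma sum_mean_ordS q (F : 'I_N -> R) :
  \sum_(k < N) (F (q k) + F (q (ordS k))) / 2 = \sum_(j < N) F j.
Proof.
have e : \sum_(k < N) F (q (ordS k)) = \sum_(k < N) F (q k).
  by rewrite [RHS](reindex_inj (@ordS_inj N)).
rewrite -mulr_suml big_split/= e [RHS](reindex_inj (@perm_inj _ q)).
by field.
Qed.

(** By linearity the sum is the half gap of the vector with entries [w j]; this turns the transport
    term into velocity differences. *)
Lemma sum_half_gap q (w : 'I_N -> R) (k : 'I_N) :
  \sum_(j < N) w j * half_gap q (delta_mx ord0 j) k =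
  (w (q k) - w (q (ordS k))) / 2.
Proof.
transitivity (half_gap q (\row_j w j) k); last by rewrite /half_gap !mxE.
rewrite /half_gap [\row_j w j]row_sum_delta !summxE -sumrB mulr_suml.
by apply: eq_bigr => j _; rewrite !mxE; ring.
Qed.

End Phases.

Theorem theorem3 (R : realType) (N : nat) (hN : (3 <= N)%N)
    (f g h : 'rV[R]_N -> R -> R)
    (f_smooth : smooth_in_phases_and_time f)
    (g_smooth : smooth_in_phases_and_time g)
    (h_smooth : smooth_in_phases_and_time h)
    (f_periodic : periodic_2pi f)
    (g_periodic : periodic_2pi g)
    (h_periodic : periodic_2pi h)
    (q : 'S_N) (theta : 'rV[R]_N) (t : R)
    (theta_distinct : distinct_mod_2pi theta) :
  PF_generator (velocity f g h) t (psi q) theta =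
  Lambda f g h theta t * psi q theta.
Proof.
have s0 k := sin_half_gap_neq0 q theta k (ltnW hN) theta_distinct.
pose p := psi q theta.
pose F (j : 'I_N) : R :=
  h theta t * cos (theta ord0 j) - g theta t * sin (theta ord0 j).
pose L (j : 'I_N) : R :=
  partial j (f ^~ t) theta + cos (theta ord0 j) * partial j (g ^~ t) theta
  + sin (theta ord0 j) * partial j (h ^~ t) theta.
pose cot k : R := cos (half_gap q theta k) / sin (half_gap q theta k).
pose w j := velocity f g h j theta t.
(* The terms [L j * p] sum to the claimed right-hand side up to sign; the bracket vanishes only
   after summation over [j]. *)
have partialE j :
    partial j (fun eta => velocity f g h j eta t * psi q eta) theta =
    L j * p + (p * F j - p * \sum_(k < N)
       cot k * (w j * half_gap q (delta_mx ord0 j) k)).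
  have Hv := is_derive_velocity f g h theta t j f_smooth g_smooth h_smooth.
  have Hp := is_derive_psi q theta (delta_mx ord0 j) s0.
  rewrite /partial (derive_val (is_derive := is_deriveM Hv Hp)).
  under [in RHS]eq_bigr do rewrite mulrCA.
  by rewrite -mulr_sumr /GRing.scale /= -/(F j) -/(L j) -/p -/(w j); ring.
rewrite /PF_generator /Lambda mulNr; congr (- _).
rewrite (eq_bigr _ (fun j _ => partialE j)) big_split/= -mulr_suml sumrB.
rewrite -!mulr_sumr exchange_big /= -(sum_mean_ordS q F).
(* With the sum of [F] rewritten as cyclic means, the two sums agree term by term in [k]. *)
rewrite [X in _ + (_ - p * X)](_ : _ =
  \sum_(k < N) (F (q k) + F (q (ordS k))) / 2); first by rewrite subrr addr0.
apply: eq_bigr => k _; rewrite -mulr_sumr sum_half_gap.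
exact: (half_cot_velocity_diff _ (f theta t) (g theta t) (h theta t) _ _ (s0 k)).
Qed.
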